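(* Let $(X,d)$ be a complete $p$-uniformly convex space (for some $1<p<\infty$ and some parameter $c>0$), let $r\ge1$ be an integer and let $T_1,\ldots,T_r:X\to X$ be firmly nonexpansive mappings. Suppose $F:=\bigcap_{i=1}^r\mathrm{Fix}(T_i)\neq\emptyset$. Let $(\varepsilon_n)_{n\in\mathbb{N}}$ be nonnegative reals with $\sum_{n=0}^\infty\varepsilon_n<\infty$, let $x_0\in X$ be any starting point, and let $(x_n)$ be any sequence in $X$ starting at $x_0$ with $$d(x_{n+1},T_{\overline{n}}x_n)\le\varepsilon_n\quad\text{for each } n\in\mathbb{N},$$ where $\overline{n}=(n\bmod r)+1$. Then $(x_n)$ is $\Delta$-convergent to some $u\in F$. If, in addition, there exists $i\in\{1,\ldots,r\}$ such that $T_i(X)$ is boundedly compact, then $(x_n)$ converges to $u$ (in the metric $d$).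
   Context: $\mathbb{N}=\{0,1,2,\ldots\}$; $\mathrm{Fix}(T)$ is the set of fixed points of $T$. In a geodesic metric space, $(1-t)x\oplus ty$ denotes the point $z$ on a geodesic segment from $x$ to $y$ with $d(z,x)=t\,d(x,y)$, $t\in[0,1]$. For $1<p<\infty$, $(X,d)$ is $p$-uniformly convex with parameter $c>0$ iff it is a geodesic space and for all $x,y,z\in X$, $t\in[0,1]$, $$d(z,(1-t)x\oplus ty)^p\le(1-t)d(z,x)^p+t\,d(z,y)^p-\frac c2\,t(1-t)\,d(x,y)^p$$ (this implies that $X$ is uniquely geodesic). $T:X\to X$ is firmly nonexpansive iff $d(Tx,Ty)\le d((1-\lambda)x\oplus\lambda Tx,(1-\lambda)y\oplus\lambda Ty)$ for all $x,y\in X$ and $\lambda\in[0,1)$. For a bounded sequence $(x_n)$ in $X$, an asymptotic center is a point $x\in X$ with $\limsup_n d(x,x_n)=\inf_{y\in X}\limsup_n d(y,x_n)$. A bounded sequence $(x_n)$ $\Delta$-converges to $x\in X$ iff $x$ is the unique asymptotic center of every subsequence of $(x_n)$. As usual, a set is boundedly compact iff each of its bounded closed subsets is compact, i.e. every bounded sequence in it has a subsequence converging to a point of the set. *)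

(* Defs.v *)
From HB Require Import structures.
From mathcomp Require Import all_boot all_order all_algebra.
From mathcomp Require Import all_classical all_reals all_analysis.

Set Implicit Arguments.
Unset Strict Implicit.
Unset Printing Implicit Defensive.

Import Order.TTheory GRing.Theory Num.Theory.
Import numFieldNormedType.Exports.

Local Open Scope classical_set_scope.
Local Open Scope ring_scope.

#[short(type="completeMetricType")]
HB.structure Definition CompleteMetric (R : numDomainType) :=
  {X of Metric R X & Complete X}.

Definition Fix (X : Type) (T : X -> X) : set X := [set x | T x = x].

Section metric_notions.
Context {R : realType} {X : metricType R}.
Implicit Types (x y z w : X) (t : R) (u : nat -> X) (A : set X) (T : X -> X).

Definition mbounded A : Prop :=
  exists a, exists M : R, forall x, A x -> mdist a x <= M.

Definition geodesic_path x y (g : R -> X) : Prop :=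
  [/\ g 0 = x, g (mdist x y) = y &
    {in `[0, mdist x y] &, forall s s', mdist (g s) (g s') = `|s - s'|}].

Definition geodesic_segment x y A : Prop :=
  exists2 g, geodesic_path x y g & A = g @` `[0, mdist x y].

Definition geodesic_space : Prop :=
  forall x y, exists A, geodesic_segment x y A.

(* [geodesic_pt x y t z]: z is a point (1 - t) x (+) t y. A relation, because
   geodesics need not be unique in a general geodesic space. *)
Definition geodesic_pt x y t z : Prop :=
  (exists2 A, geodesic_segment x y A & A z) /\ mdist z x = t * mdist x y.

Definition uniformly_convex (p c : R) : Prop :=
  geodesic_space /\
  forall x y z w t, 0 <= t <= 1 -> geodesic_pt x y t w ->
    mdist z w `^ p <= (1 - t) * mdist z x `^ p + t * mdist z y `^ p
                      - c / 2 * t * (1 - t) * mdist x y `^ p.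

Definition firmly_nonexpansive T : Prop :=
  forall x y (l : R) a b, 0 <= l < 1 ->
    geodesic_pt x (T x) l a -> geodesic_pt y (T y) l b ->
    mdist (T x) (T y) <= mdist a b.

Definition asymptotic_radius_at u y : \bar R :=
  limn_esup (fun n => (mdist y (u n))%:E).

Definition asymptotic_center u x : Prop :=
  asymptotic_radius_at u x = ereal_inf (range (asymptotic_radius_at u)).

Definition delta_cvg u x : Prop :=
  mbounded (range u) /\
  forall phi : nat -> nat, {homo phi : m n / (m < n)%N} ->
    asymptotic_center (u \o phi) x /\
    forall y, asymptotic_center (u \o phi) y -> y = x.

(* The closed subsets of A are meant in the subspace topology of A, i.e. they
   are the sets A `&` C with C closed in X; so a boundedly compact A is itself
   closed in X. *)
Definition boundedly_compact A : Prop :=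
  forall C : set X, closed C -> mbounded (A `&` C) -> compact (A `&` C).

End metric_notions.

Arguments geodesic_space {R} X.
Arguments uniformly_convex {R} X p c.

(* Main.v *)
Require Import Defs.
From HB Require Import structures.
From mathcomp Require Import all_boot all_order all_algebra.
From mathcomp Require Import all_classical all_reals all_analysis.
From mathcomp Require Import lra.

Set Implicit Arguments.
Unset Strict Implicit.
Unset Printing Implicit Defensive.

Import Order.TTheory GRing.Theory Num.Theory.
Import numFieldNormedType.Exports.

Local Open Scope classical_set_scope.
Local Open Scope ring_scope.

(** Comparing a firmly nonexpansive [T] with one of its fixed points [z] at the
midpoint of [x] and [T x], uniform convexity gives
[c/4 d(x,Tx)^p <= d(x,z)^p - d(Tx,z)^p]. Along the inexact cyclic iteration
[d(x_n,z)] is nonincreasing up to a summable error, hence converges for every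
common fixed point [z]; so [d(x_n,T_i x_n)] tends to [0] for every [i].

In a complete uniformly convex space a bounded sequence has exactly one
asymptotic center, and by the previous limit the center of every subsequence of
[(x_n)] is a common fixed point. As the distances to common fixed points
converge, the asymptotic radius at such a point is the same for all
subsequences, so all these centers agree. If [T_i(X)] is boundedly compact,
[(T_i x_n)] has a cluster point [q]; it is a common fixed point at which
[d(x_n,q)] converges and gets arbitrarily small, so [x_n] tends to [q]. *)

(** * Real sequences: powers, almost decreasing sequences, summable errors *)

Section powR_limits.
Context {R : realType}.
Implicit Types (u : nat -> R) (l p : R).

Lemma powRVK p l : 0 < p -> 0 <= l -> (l `^ p) `^ p^-1 = l.
Proof. by move=> p0 l0; rewrite -powRrM mulfV ?gt_eqF// powRr1. Qed.

Lemma powRKV p l : 0 < p -> 0 <= l -> (l `^ p^-1) `^ p = l.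
Proof. by move=> p0 l0; rewrite -powRrM mulVf ?gt_eqF// powRr1. Qed.

(** For positive [l] this is continuity of the power, obtained from derivability at [l]. The value
    [l = 0] is treated by hand: [u n] below [e]^ p^-1[puts]u n [^ p] below [e]. *)
Lemma cvg_powR u l p : 0 < p -> (forall n, 0 <= u n) ->
  u @ \oo --> l -> u n `^ p @[n --> \oo] --> l `^ p.
Proof.
move=> p0 u0 ul.
have l0 : 0 <= l by apply: (cvgr_to_ge ul); exact: nearW.
move: l0; rewrite le_eqVlt => /predU1P[l0|l0].
  rewrite -l0 powR0 ?gt_eqF//; rewrite -l0 in ul.
  apply/cvgr0Pnorm_lt => e e0.
  have /cvgr0Pnorm_lt/(_ _ (powR_gt0 p^-1 e0)) := ul.
  apply: filterS => n; rewrite !ger0_norm ?powR_ge0// => une.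
  by rewrite -[ltRHS](powRKV p0 (ltW e0)) gt0_ltr_powR// nnegrE// powR_ge0.
have dl : derivable (fun a : R => a `^ p) l 1.
  by apply: derivable_powR; rewrite in_itv/= l0.
have cl : {for l, continuous (fun a : R => a `^ p)}.
  by apply: differentiable_continuous; exact/derivable1_diffP.
exact: (continuous_cvg _ cl ul).
Qed.

(** Subtracting the partial sums of [e] from [a] leaves a nonincreasing sequence, bounded below by
    minus the total sum. *)
Lemma quasi_decreasing_is_cvgn (a e : nat -> R) :
  (forall n, 0 <= a n) -> (forall n, 0 <= e n) -> cvgn (series e) ->
  (forall n, a n.+1 <= a n + e n) -> cvgn a.
Proof.
move=> a0 e0 se ae.
have cd : cvgn (a - series e).
  apply: nonincreasing_is_cvgn.
    apply/nonincreasing_seqP => n /=; rewrite !fctE /series/=.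
    by rewrite big_nat_recr//=; have := ae n; lra.
  exists (- limn (series e)) => _ [n _ <-]; rewrite !fctE.
  rewrite -[leLHS]add0r lerD// lerN2; apply: nondecreasing_cvgn_le => //.
  by apply/nondecreasing_seqP => k; rewrite /series/= big_nat_recr//= lerDl.
have -> : a = (a - series e) + series e by rewrite subrK.
exact: is_cvgD.
Qed.

Lemma summable_is_cvg_series (e : nat -> R) : (forall n, 0 <= e n) ->
  (\sum_(0 <= n <oo) (e n)%:E < +oo)%E -> cvgn (series e).
Proof.
move=> e0 soo; apply: nondecreasing_is_cvgn.
  by apply/nondecreasing_seqP => k; rewrite /series/= big_nat_recr//= lerDl.
have s0 : (0 <= \sum_(0 <= n <oo) (e n)%:E)%E.
  by apply: nneseries_ge0 => n _ _; rewrite lee_fin.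
exists (fine (\sum_(0 <= n <oo) (e n)%:E)%E) => _ [n _ <-].
rewrite -lee_fin fineK ?ge0_fin_numE// /series/= -sumEFin.
by apply: nneseries_lim_ge => k _ _; rewrite lee_fin.
Qed.

End powR_limits.

(** * Geodesic points and firmly nonexpansive maps *)

Section geodesics.
Context {R : realType} {X : metricType R}.
Implicit Types (x y z : X) (t : R).

Lemma mdist0_eq x y : mdist x y <= 0 -> x = y.
Proof.
move=> xy; apply: mdist_positivity; apply/eqP.
by rewrite eq_le xy mdist_ge0.
Qed.

Lemma geodesic_pt_ex x y t : geodesic_space X -> 0 <= t <= 1 ->
  exists z, geodesic_pt x y t z.
Proof.
move=> /(_ x y)[A [g [g0 gd gi] _]] /andP[t0 t1].
have d0 := mdist_ge0 x y.
have td : t * mdist x y \in `[0, mdist x y].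
  by rewrite in_itv/= mulr_ge0//= ler_piMl.
exists (g (t * mdist x y)); split.
  exists (g @` `[0, mdist x y]); first by exists g.
  by exists (t * mdist x y).
rewrite -[X in mdist _ X]g0 gi//; last by rewrite in_itv/= lexx.
by rewrite subr0 ger0_norm// mulr_ge0.
Qed.

Lemma geodesic_pt0 x y : geodesic_space X -> geodesic_pt x y 0 x.
Proof.
move=> /(@geodesic_pt_ex x y 0)[|z xz]; first by rewrite lexx ler01.
by have [_] := xz; rewrite mul0r => /mdist_positivity zx; rewrite zx in xz.
Qed.

Lemma geodesic_ptxx x t : geodesic_space X -> 0 <= t <= 1 ->
  geodesic_pt x x t x.
Proof.
move=> gX /(@geodesic_pt_ex x x t gX)[z xz].
by have [_] := xz; rewrite mdistxx mulr0 => /mdist_positivity zx; rewrite zx in xz.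
Qed.

(** Parameter 0 in firm nonexpansiveness, where the two geodesic points are [x] and [y]
    themselves. *)
Lemma firmly_nonexpansive_nonexpansive (T : X -> X) x y :
  geodesic_space X -> firmly_nonexpansive T ->
  mdist (T x) (T y) <= mdist x y.
Proof.
move=> gX /(_ x y 0 x y); apply; first by rewrite lexx ltr01.
- exact: geodesic_pt0.
- exact: geodesic_pt0.
Qed.

(** As [T z = z], the point [z] is its own midpoint with [T z], so [T x] is at least as close to [z]
    as the midpoint [w] of [x] and [T x]. Uniform convexity at [w] has the gain c/8; moving half of
    d(Tx,z)^p to the left and doubling turns it into c/4. *)
Lemma firmly_nonexpansive_fix_ineq (p c : R) (T : X -> X) x z :
  0 < p -> uniformly_convex X p c -> firmly_nonexpansive T -> Fix T z ->
  c / 4 * mdist x (T x) `^ p <= mdist x z `^ p - mdist (T x) z `^ p.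
Proof.
move=> p0 [gX cX] fT Tz.
have t01 : 0 <= (2^-1 : R) <= 1 by lra.
have [w xw] := geodesic_pt_ex x (T x) gX t01.
have /= := cX _ _ z _ _ t01 xw; rewrite !(metric_sym z) => H.
have {}H' : mdist (T x) z `^ p <= mdist w z `^ p.
  rewrite ge0_ler_powR ?nnegrE ?mdist_ge0 ?(ltW p0)//.
  rewrite -[X in mdist _ X]Tz; apply: (fT _ _ 2^-1) => //; first by lra.
  by rewrite Tz; exact: geodesic_ptxx.
by lra.
Qed.

End geodesics.

(** * Elementary properties of the asymptotic radius *)

Section asymptotic_radius.
Context {R : realType} {X : metricType R}.
Implicit Types (x y : X) (u : nat -> X) (a : R).

Lemma asymptotic_radius_lt u y a : (asymptotic_radius_at u y < a%:E)%E ->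
  \forall n \near \oo, mdist y (u n) < a.
Proof.
move=> /ereal_inf_lt[_ [V Voo <-] Va]; apply: filterS Voo => n Vn.
by rewrite -lte_fin; apply: le_lt_trans Va; apply: ereal_sup_ubound; exists n.
Qed.

Lemma asymptotic_radius_le u y a : (\forall n \near \oo, mdist y (u n) <= a) ->
  (asymptotic_radius_at u y <= a%:E)%E.
Proof.
move=> ua; pose V := [set n | mdist y (u n) <= a].
apply: (@le_trans _ _ (ereal_sup ((fun n => (mdist y (u n))%:E) @` V))).
  by apply: ereal_inf_lbound; exists V.
by apply: ge_ereal_sup => _ [n Vn <-]; rewrite lee_fin.
Qed.

Lemma asymptotic_radius_ge0 u y : (0 <= asymptotic_radius_at u y)%E.
Proof.
apply: le_ereal_inf_tmp => _ [V /filter_ex[n Vn] <-].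
apply: (@le_trans _ _ (mdist y (u n))%:E); first by rewrite lee_fin mdist_ge0.
by apply: ereal_sup_ubound; exists n.
Qed.

Lemma asymptotic_radius_fin_num u y : mbounded (range u) ->
  asymptotic_radius_at u y \is a fin_num.
Proof.
move=> [z [M uM]]; rewrite ge0_fin_numE ?asymptotic_radius_ge0//.
apply: (@le_lt_trans _ _ (mdist y z + M)%:E); last exact: ltry.
apply/asymptotic_radius_le/nearW => n.
by rewrite (le_trans (metric_triangle _ z _))// lerD2l uM.
Qed.

Lemma asymptotic_centerP u x : asymptotic_center u x <->
  forall y, (asymptotic_radius_at u x <= asymptotic_radius_at u y)%E.
Proof.
split=> [-> y|xy]; first by apply: ereal_inf_lbound; exists y.
apply/eqP; rewrite eq_le; apply/andP; split.
  by apply: le_ereal_inf_tmp => _ [y _ <-].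
by apply: ereal_inf_lbound; exists x.
Qed.

Lemma asymptotic_radius_inf_ge0 u :
  (0 <= ereal_inf (range (asymptotic_radius_at u)))%E.
Proof.
by apply: le_ereal_inf_tmp => _ [y _ <-]; exact: asymptotic_radius_ge0.
Qed.

Lemma asymptotic_radius_inf_fin_num u : mbounded (range u) ->
  ereal_inf (range (asymptotic_radius_at u)) \is a fin_num.
Proof.
move=> ub; rewrite ge0_fin_numE ?asymptotic_radius_inf_ge0//.
apply: (@le_lt_trans _ _ (asymptotic_radius_at u (u 0%N))).
  by apply: ereal_inf_lbound; exists (u 0%N).
by rewrite ltey_eq asymptotic_radius_fin_num.
Qed.

Lemma asymptotic_radius_cvg u y a : mdist y (u n) @[n --> \oo] --> a ->
  asymptotic_radius_at u y = a%:E.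
Proof.
move=> ua; rewrite /asymptotic_radius_at; have /cvg_limn_einf_sup[] // :
  (mdist y (u n))%:E @[n --> \oo] --> a%:E by apply: cvg_EFin ua; exact: nearW.
Qed.

End asymptotic_radius.

(** * Asymptotic centers under uniform convexity: uniqueness, existence, fixed points *)

Section asymptotic_center_uniformly_convex.
Context {R : realType} {X : metricType R} (p c : R).
Hypotheses (p0 : 0 < p) (c0 : 0 < c) (cX : uniformly_convex X p c).
Implicit Types (x y : X) (u : nat -> X) (a e m : R).

(* Almost all the u n lie within a of both y and y', hence, by uniform
   convexity, within (a^p - c/8 d(y,y')^p)^(1/p) of their midpoint. *)
Lemma mdist_le_asymptotic_radius u m a y y' :
  ereal_inf (range (asymptotic_radius_at u)) = m%:E ->
  (asymptotic_radius_at u y < a%:E)%E -> (asymptotic_radius_at u y' < a%:E)%E ->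
  c / 8 * mdist y y' `^ p <= a `^ p - m `^ p.
Proof.
move=> um ya y'a; have [gX ucX] := cX.
have t01 : 0 <= (2^-1 : R) <= 1 by lra.
have [w yw] := geodesic_pt_ex y y' gX t01.
have m0 : 0 <= m by rewrite -lee_fin -um asymptotic_radius_inf_ge0.
pose K := a `^ p - c / 8 * mdist y y' `^ p.
have wK : \forall n \near \oo, mdist w (u n) `^ p <= K.
  near=> n.
  have un z : mdist z (u n) < a -> mdist (u n) z `^ p <= a `^ p.
    move=> zn; rewrite metric_sym ge0_ler_powR ?nnegrE ?mdist_ge0 ?(ltW p0)//.
      by rewrite (le_trans _ (ltW zn))// mdist_ge0.
    exact: ltW.
  have yn : mdist (u n) y `^ p <= a `^ p.
    by apply: un; near: n; exact: asymptotic_radius_lt.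
  have y'n : mdist (u n) y' `^ p <= a `^ p.
    by apply: un; near: n; exact: asymptotic_radius_lt.
  have := ucX _ _ (u n) _ _ t01 yw; rewrite /K (metric_sym w); lra.
have K0 : 0 <= K.
  by have [n] := filter_ex wK; apply: le_trans; exact: powR_ge0.
suff : m `^ p <= K by rewrite /K; lra.
rewrite -[leRHS](powRKV p0)// ge0_ler_powR ?nnegrE ?powR_ge0 ?(ltW p0)//.
rewrite -lee_fin -um; apply: (@le_trans _ _ (asymptotic_radius_at u w)).
  by apply: ereal_inf_lbound; exists w.
apply: asymptotic_radius_le; apply: filterS wK => n wK.
rewrite -(powRVK p0 (mdist_ge0 w (u n))).
by rewrite ge0_ler_powR ?nnegrE ?powR_ge0 ?invr_ge0 ?(ltW p0).
Unshelve. all: by end_near. Qed.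

(** Sublevel sets of the asymptotic radius shrink in diameter to 0 as the level decreases to the
    infimum. This yields both uniqueness of centers and the Cauchy property of minimizing
    sequences. *)
Lemma near_asymptotic_center u m e :
  ereal_inf (range (asymptotic_radius_at u)) = m%:E -> 0 < e ->
  exists2 a, m < a & forall y y', (asymptotic_radius_at u y < a%:E)%E ->
    (asymptotic_radius_at u y' < a%:E)%E -> mdist y y' < e.
Proof.
move=> um e0.
have m0 : 0 <= m by rewrite -lee_fin -um asymptotic_radius_inf_ge0.
have d0 : 0 < c / 16 * e `^ p by rewrite mulr_gt0 ?powR_gt0// divr_gt0.
(* The level a = K^(1/p) exceeds m^p by only half of c/8 e^p after taking p-th powers, so a distance
   of at least e would violate the preceding bound. *)
pose K := m `^ p + c / 16 * e `^ p.
have K0 : 0 <= K by rewrite addr_ge0 ?powR_ge0 ?ltW.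
exists (K `^ p^-1).
  rewrite -[ltLHS](powRVK p0)// gt0_ltr_powR ?nnegrE ?powR_ge0 ?invr_gt0//.
  by rewrite /K ltrDl.
move=> y y' ya y'a; have := mdist_le_asymptotic_radius um ya y'a.
rewrite powRKV// /K => H; rewrite ltNge; apply/negP => ed.
have /(ler_wpM2l (ltW c0)) : e `^ p <= mdist y y' `^ p.
  by rewrite ge0_ler_powR ?nnegrE ?mdist_ge0 ?(ltW p0) ?(ltW e0).
by lra.
Qed.

Lemma asymptotic_center_unique u x y : mbounded (range u) ->
  asymptotic_center u x -> asymptotic_center u y -> x = y.
Proof.
move=> ub ux uy; have /fineK/esym um := asymptotic_radius_inf_fin_num ub.
apply: mdist0_eq; apply/ler_addgt0Pl => e e0; rewrite addr0.
have [a ma H] := near_asymptotic_center um e0.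
by apply/ltW/H; rewrite (ux, uy) um lte_fin.
Qed.

End asymptotic_center_uniformly_convex.

(** A minimizing sequence for the asymptotic radius is Cauchy; its limit is a minimizer because
    moving the base point by some distance changes the radius by at most that distance. *)
Lemma asymptotic_center_exists (R : realType) (X : completeMetricType R)
    (p c : R) (u : nat -> X) :
  0 < p -> 0 < c -> uniformly_convex X p c -> mbounded (range u) ->
  exists x, asymptotic_center u x.
Proof.
move=> p0 c0 cX ub; have /fineK/esym um := asymptotic_radius_inf_fin_num ub.
set m := fine _ in um.
have /choice[y_ yE] (k : nat) :
    exists y, (asymptotic_radius_at u y < (m + k.+1%:R^-1)%:E)%E.
  have : (ereal_inf (range (asymptotic_radius_at u)) < (m + k.+1%:R^-1)%:E)%E.
    by rewrite um lte_fin ltrDl invr_gt0.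
  by move=> /ereal_inf_lt[_ [y _ <-] ?]; exists y.
have ya a : m < a -> \forall k \near \oo, (asymptotic_radius_at u (y_ k) < a%:E)%E.
  move=> ma; have am : 0 < a - m by rewrite subr_gt0.
  near=> k; apply: lt_trans (yE k) _.
  rewrite lte_fin -ltrBrDl; near: k; exact: (near_infty_natSinv_lt (PosNum am)).
have : cvg (y_ @ \oo).
  suff : cauchy_ex (y_ @ \oo) by move=> /cauchy_exP; exact: cauchy_cvg.
  move=> e e0.
  have [a ma H] := near_asymptotic_center p0 c0 cX um e0.
  have [k yk] := filter_ex (ya _ ma).
  exists (y_ k); rewrite ballEmdist /=.
  by apply: filterS (ya _ ma) => l yl; exact: H.
move=> /cvg_ex[x yx]; exists x; apply/asymptotic_centerP => z.
apply: (@le_trans _ _ m%:E); last first.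
  by rewrite -um; apply: ereal_inf_lbound; exists z.
apply/lee_addgt0Pr => e e0; rewrite -EFinD.
have e20 : 0 < e / 2 by rewrite divr_gt0.
have [k [yk xk]] : exists k,
    (asymptotic_radius_at u (y_ k) < (m + e / 2)%:E)%E /\ mdist x (y_ k) < e / 2.
  have /ya mk : m < m + e / 2 by rewrite ltrDl.
  have /metricType_numDomainType.cvgrPdist_lt/(_ _ e20) xk := yx.
  by have [k []] := filter_ex (filterI mk xk); exists k.
apply: asymptotic_radius_le; have := asymptotic_radius_lt yk.
apply: filterS => n yn; apply: le_trans (metric_triangle _ (y_ k) _) _; lra.
Unshelve. all: by end_near. Qed.

(** Since d(Tv,u_n) <= d(v,u_n) + d(u_n,Tu_n), the radius at [T v] is at most that at [v]. So [T v]
    is a center too, and uniqueness gives [T v = v]. *)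
Lemma asymptotic_center_fix (R : realType) (X : metricType R) (p c : R)
    (u : nat -> X) (T : X -> X) (v : X) :
  0 < p -> 0 < c -> uniformly_convex X p c -> mbounded (range u) ->
  firmly_nonexpansive T -> mdist (u n) (T (u n)) @[n --> \oo] --> 0 ->
  asymptotic_center u v -> Fix T v.
Proof.
move=> p0 c0 cX ub fT uT uv.
apply: (asymptotic_center_unique p0 c0 cX ub _ uv).
apply/asymptotic_centerP => y.
apply: le_trans ((asymptotic_centerP _ _).1 uv y).
have /fineK <- := asymptotic_radius_fin_num v ub.
set a := fine _; apply/lee_addgt0Pr => e e0; rewrite -EFinD.
have e20 : 0 < e / 2 by rewrite divr_gt0.
apply: asymptotic_radius_le.
have va : \forall n \near \oo, mdist v (u n) < a + e / 2.
  apply: asymptotic_radius_lt.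
  by rewrite -[ltLHS]fineK ?asymptotic_radius_fin_num// lte_fin ltrDl.
have uTe : \forall n \near \oo, mdist (u n) (T (u n)) < e / 2.
  exact: cvgr_lt uT _ e20.
near=> n; apply: le_trans (metric_triangle _ (T (u n)) _) _.
have := firmly_nonexpansive_nonexpansive v (u n) cX.1 fT.
have : mdist v (u n) < a + e / 2 by near: n.
have : mdist (u n) (T (u n)) < e / 2 by near: n.
by rewrite [mdist (T (u n)) (u n)]metric_sym; lra.
Unshelve. all: by end_near. Qed.

(** * The inexact cyclic iteration: asymptotic regularity and cluster points *)

Section cyclic_iteration.
Context {R : realType} {X : metricType R} (p c : R).
Hypotheses (p0 : 0 < p) (c0 : 0 < c) (cX : uniformly_convex X p c).
Context (r : nat) (r_gt0 : (0 < r)%N) (T : 'I_r -> X -> X).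
Hypotheses (Tfne : forall i, firmly_nonexpansive (T i)).
Context (eps : nat -> R).
Hypotheses (eps_ge0 : forall n, 0 <= eps n) (eps_sum : cvgn (series eps)).
Context (x : nat -> X).
(** Indices in ['I_r] start at 0, so n mod r needs no shift by one. *)
Let Tn n := T (Ordinal (ltn_pmod n r_gt0)).
Hypothesis x_step : forall n, mdist (x n.+1) (Tn n (x n)) <= eps n.
Implicit Types (z : X) (i : 'I_r).
Let F := \bigcap_i Fix (T i).

Lemma cyclic_mdist_fix_le z n : F z -> mdist (Tn n (x n)) z <= mdist (x n) z.
Proof.
move=> Fz; have Tz : Tn n z = z by exact: Fz.
rewrite -[X in mdist _ X <= _]Tz.
exact: (firmly_nonexpansive_nonexpansive _ _ cX.1 (@Tfne _)).
Qed.

Lemma cyclic_mdist_fix_cvg z : F z -> cvgn (fun n => mdist (x n) z).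
Proof.
move=> Fz; apply: quasi_decreasing_is_cvgn eps_ge0 eps_sum _ => n.
  exact: mdist_ge0.
have := cyclic_mdist_fix_le n Fz; have := x_step n.
have := metric_triangle (x n.+1) (Tn n (x n)) z; lra.
Qed.

Lemma cyclic_regular_step : F !=set0 ->
  mdist (x n) (Tn n (x n)) @[n --> \oo] --> 0.
Proof.
move=> [z Fz]; have /cvg_ex[l al] := cyclic_mdist_fix_cvg Fz.
have e0 := cvg_series_cvg_0 eps_sum.
(* d(T_n x_n,z) is squeezed between d(x_{n+1},z) - eps_n and d(x_n,z), which have the same limit. *)
have bl : mdist (Tn n (x n)) z @[n --> \oo] --> l.
  apply: (@squeeze_cvgr _ _ _ _ (fun n => mdist (x n.+1) z - eps n) _ _ _ _ _ al).
    apply: nearW => n; rewrite cyclic_mdist_fix_le// andbT.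
    have := x_step n; have := metric_triangle (x n.+1) (Tn n (x n)) z; lra.
  rewrite -[l]subr0; apply: cvgB => //.
  by rewrite (cvg_shiftS (fun n => mdist (x n) z)).
have d0 : mdist (x n) (Tn n (x n)) `^ p @[n --> \oo] --> 0.
  have : 4 / c * (mdist (x n) z `^ p - mdist (Tn n (x n)) z `^ p) @[n --> \oo]
      --> 4 / c * (l `^ p - l `^ p).
    apply: cvgMr; apply: cvgB; apply: cvg_powR => // n; exact: mdist_ge0.
  rewrite subrr mulr0; apply: squeeze_cvgr; last exact: cvg_cst.
  apply: nearW => n; rewrite powR_ge0/=.
  rewrite -ler_pdivrMl ?divr_gt0// invf_div.
  exact: (firmly_nonexpansive_fix_ineq _ p0 cX (@Tfne _) (Fz _ I)).
have pV0 : 0 < p^-1 by rewrite invr_gt0.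
have := cvg_powR pV0 (fun n => powR_ge0 _ _) d0.
rewrite powR0 ?gt_eqF//; apply: cvg_trans; apply: near_eq_cvg.
by apply: nearW => n /=; rewrite powRVK ?mdist_ge0.
Qed.

Lemma cyclic_regular i : F !=set0 ->
  mdist (x n) (T i (x n)) @[n --> \oo] --> 0.
Proof.
move=> F0; have d0 := cyclic_regular_step F0.
have e0 := cvg_series_cvg_0 eps_sum.
apply/cvgr0Pnorm_lt => e e_gt0.
(* The final estimate is 2kq + q + 2kq with k < r: from x_n to x_{n+k}, on to its image under T_i,
   and back to T_i x_n by nonexpansiveness. *)
pose q := e / (4 * r%:R + 1).
have q0 : 0 < q by rewrite divr_gt0// ltr_wpDl// mulr_ge0.
have [N _ HN] : \forall n \near \oo,
    mdist (x n) (Tn n (x n)) < q /\ eps n < q.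
  by apply: filterI; [exact: cvgr_lt d0 _ q0|exact: cvgr_lt e0 _ q0].
(* Each step moves by at most 2q: q for the displacement under the map and q for the error. *)
have xk n k : (N <= n)%N -> mdist (x n) (x (n + k)%N) <= 2 * k%:R * q.
  move=> Nn; elim: k => [|k IH]; first by rewrite addn0 mdistxx mulr0 mul0r.
  rewrite addnS; apply: le_trans (metric_triangle _ (x (n + k)%N) _) _.
  have [|h1 h2] := HN (n + k)%N; first by rewrite /= (leq_trans Nn)// leq_addr.
  have := x_step (n + k).
  have := metric_triangle (x (n + k)%N) (Tn (n + k) (x (n + k)%N)) (x (n + k).+1).
  rewrite (metric_sym (Tn _ _)) -natr1; lra.
exists N => // n /= Nn; rewrite ger0_norm ?mdist_ge0//.
(* The waiting time until T_i is applied is i - n modulo r; [r - n %% r] stands for -n to avoid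
   truncated subtraction. *)
have [k kr ki] : exists2 k, (k < r)%N & ((n + k) %% r = i)%N.
  exists ((i + (r - n %% r)) %% r)%N; first by rewrite ltn_pmod.
  rewrite modnDmr addnCA -modnDmr -modnDml.
  have -> : ((n + (r - n %% r)) %% r = 0)%N.
    by rewrite -modnDml subnKC ?modnn// ltnW// ltn_pmod.
  by rewrite addn0 modn_mod modn_small.
have [|h1 h2] := HN (n + k)%N; first by rewrite /= (leq_trans Nn)// leq_addr.
have TE : Tn (n + k) = T i by rewrite /Tn; congr T; exact: val_inj.
have := xk n k Nn; rewrite TE in h1.
have := firmly_nonexpansive_nonexpansive (x n) (x (n + k)%N) cX.1 (@Tfne i).
have := metric_triangle (x n) (x (n + k)%N) (T i (x n)).
have := metric_triangle (x (n + k)%N) (T i (x (n + k)%N)) (T i (x n)).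
rewrite (metric_sym (T i (x (n + k)%N)) (T i (x n))) => t1 t2 t3 t4.
have : 4 * k%:R * q + q <= e.
  rewrite [leRHS](_ : e = (4 * r%:R + 1) * q); last first.
    by rewrite mulrC divfK// gt_eqF// ltr_wpDl// mulr_ge0.
  rewrite [leRHS]mulrDl mul1r lerD2r ler_wpM2r ?(ltW q0)// ler_wpM2l//.
  by rewrite ler_nat ltnW.
lra.
Unshelve. all: by end_near. Qed.

Lemma cyclic_bounded : F !=set0 -> mbounded (range x).
Proof.
move=> [z Fz]; have /cvg_seq_bounded[M [_ xM]] := cyclic_mdist_fix_cvg Fz.
exists z, (M + 1) => _ [n _ <-]; rewrite metric_sym.
have := xM (M + 1); rewrite ltrDl ltr01 => /(_ isT n I) /=.
by rewrite ger0_norm ?mdist_ge0.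
Qed.

Lemma cyclic_cluster_cvg i y : F !=set0 ->
  cluster (T i (x n) @[n --> \oo]) y -> x @ \oo --> y.
Proof.
move=> F0 cy.
(* The cluster point of (T_i x_n) is also approached by x_n at arbitrarily late indices, as
   d(x_n,T_i x_n) tends to 0. *)
have close e N : 0 < e -> exists2 n, (N <= n)%N & mdist (x n) y < e.
  move=> e0; have e20 : 0 < e / 2 by rewrite divr_gt0.
  have Nn : (T i (x n) @[n --> \oo]) [set T i (x n) | n in
      [set n | (N <= n)%N /\ mdist (x n) (T i (x n)) < e / 2]].
    have Nge : \forall n \near \oo, (N <= n)%N by exact: nbhs_infty_ge.
    have /cvgr_lt/(_ _ e20) nT := cyclic_regular i F0.
    by apply: filterS (filterI Nge nT) => n [? ?]; exists n.
  have [_ [[n [Nn' nT] <-]]] := cy _ _ Nn (nbhsx_ballx y _ e20).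
  rewrite ballEmdist/= => yT; exists n => //.
  have := metric_triangle (x n) (T i (x n)) y.
  rewrite (metric_sym (T i (x n)) y); lra.
(* At a late n with x_n near y, each of d(y,x_n), d(x_n,T_j x_n) and d(T_j x_n,T_j y) is below
   e/3. *)
have Fy : F y.
  move=> j _; apply/esym/mdist0_eq/ler_addgt0Pl => e e0; rewrite addr0.
  have e30 : 0 < e / 3 by rewrite divr_gt0.
  have /cvgr_lt/(_ _ e30)[N _ HN] := cyclic_regular j F0.
  have [n /HN/= nT ny] := close _ N e30.
  have := firmly_nonexpansive_nonexpansive (x n) y cX.1 (@Tfne j).
  have := metric_triangle y (x n) (T j y).
  have := metric_triangle (x n) (T j (x n)) (T j y).
  rewrite (metric_sym y (x n)); lra.
have /cvg_ex[l al] := cyclic_mdist_fix_cvg Fy.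
have l0 : l <= 0.
  apply/ler_addgt0Pl => e e0; rewrite addr0 leNgt; apply/negP => el.
  have /cvgr_gt/(_ _ el)[N _ HN] := al.
  have [n /HN/= nT ny] := close _ N e0.
  by rewrite ltNge (ltW nT) in ny.
apply/metricType_numDomainType.cvgrPdist_lt => e e0.
have /cvgr_lt/(_ _ (le_lt_trans l0 e0)) := al; apply: filterS => n.
by rewrite metric_sym.
Unshelve. all: by end_near. Qed.

End cyclic_iteration.

Theorem theorem4p1 (R : realType) (X : completeMetricType R) (p c : R)
    (p_gt1 : 1 < p) (c_gt0 : 0 < c) (Xconvex : uniformly_convex X p c)
    (r : nat) (r_gt0 : (0 < r)%N) (T : 'I_r -> X -> X)
    (Tfne : forall i, firmly_nonexpansive (T i))
    (F_neq0 : \bigcap_i Fix (T i) !=set0)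
    (eps : nat -> R) (eps_ge0 : forall n, 0 <= eps n)
    (eps_sum : (\sum_(0 <= n <oo) (eps n)%:E < +oo)%E)
    (x0 : X) (x : nat -> X) (x_init : x 0%N = x0)
    (x_step : forall n,
      mdist (x n.+1) (T (Ordinal (ltn_pmod n r_gt0)) (x n)) <= eps n) :
  exists u : X,
    [/\ (\bigcap_i Fix (T i)) u,
        delta_cvg x u &
        (exists i, boundedly_compact (range (T i))) -> x @ \oo --> u].
Proof.
have p0 : 0 < p by apply: lt_trans p_gt1; exact: ltr01.
have esum := summable_is_cvg_series eps_ge0 eps_sum.
have xb := cyclic_bounded Xconvex Tfne eps_ge0 esum x_step F_neq0.
have phib (phi : nat -> nat) : mbounded (range (x \o phi)).
  by have [a [M xM]] := xb; exists a, M => _ [n _ <-]; apply: xM; exists (phi n).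
have phioo (phi : nat -> nat) : {homo phi : m n / (m < n)%N} -> phi @ \oo --> \oo.
  move=> phi_lt; apply/cvgnyPge => N; near=> n.
  apply: (@leq_trans n); first by near: n; exact: nbhs_infty_ge.
  by elim: (n) => // k /leq_ltn_trans; apply; exact: phi_lt.
have Fcenter (phi : nat -> nat) v : {homo phi : m n / (m < n)%N} ->
    asymptotic_center (x \o phi) v -> (\bigcap_i Fix (T i)) v.
  move=> /phioo phi_oo xv i _.
  apply: (asymptotic_center_fix p0 c_gt0 Xconvex (phib phi) (Tfne i) _ xv).
  have := cyclic_regular p0 c_gt0 Xconvex Tfne eps_ge0 esum x_step i F_neq0.
  exact: cvg_comp phi_oo.
(* At a common fixed point the distances converge, so every subsequence has the same limit
   superior. *)
have Fradius (phi : nat -> nat) v : {homo phi : m n / (m < n)%N} ->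
    (\bigcap_i Fix (T i)) v ->
    asymptotic_radius_at (x \o phi) v = asymptotic_radius_at x v.
  move=> /phioo phi_oo Fv.
  have /cvg_ex[l] := cyclic_mdist_fix_cvg Xconvex Tfne eps_ge0 esum x_step Fv.
  under eq_fun do rewrite metric_sym; move=> xl.
  rewrite (asymptotic_radius_cvg xl); apply: asymptotic_radius_cvg.
  exact: cvg_comp phi_oo xl.
have [u xu] := asymptotic_center_exists p0 c_gt0 Xconvex xb.
have Fu : (\bigcap_i Fix (T i)) u by apply: (Fcenter id).
exists u; split => //.
- split=> // phi phi_lt.
  have [v xv] := asymptotic_center_exists p0 c_gt0 Xconvex (phib phi).
  have Fv := Fcenter _ _ phi_lt xv.
  (* Writing r and r_phi for the radii along x and the subsequence: r_phi(u) = r(u) <= r(v) =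
     r_phi(v) <= r_phi(y). *)
  have xphiu : asymptotic_center (x \o phi) u.
    apply/asymptotic_centerP => y.
    apply: le_trans ((asymptotic_centerP _ _).1 xv y).
    by rewrite !Fradius//; exact: (asymptotic_centerP _ _).1.
  split=> // y xy.
  exact: (asymptotic_center_unique p0 c_gt0 Xconvex (phib phi) xy xphiu).
- move=> [i Tic].
  have [a [M xM]] := xb; have [z Fz] := F_neq0.
  (* A closed ball about the fixed point z containing all x_n, hence all T_i x_n. *)
  pose C := [set y | mdist z y <= mdist z a + M].
  have Ccl : closed C.
    move=> y Cy; apply/ler_addgt0Pl => e e0.
    have [w [Cw]] := Cy _ (nbhsx_ballx y _ e0); rewrite ballEmdist/= => yw.
    have := metric_triangle z w y; rewrite (metric_sym w) => zw.
    by move: Cw; rewrite /C/=; lra.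
  have /(Tic C Ccl) Cc : mbounded (range (T i) `&` C).
    by exists z, (mdist z a + M) => y [].
  have [|y [_ cy]] := Cc (T i (x n) @[n --> \oo]) _.
    exists 0%N => // n _; split; first by exists (x n).
    rewrite /C/= -[X in mdist X _](Fz i I).
    apply: le_trans (firmly_nonexpansive_nonexpansive z (x n) Xconvex.1 (Tfne i)) _.
    by rewrite (le_trans (metric_triangle _ a _))// lerD2l; apply: xM; exists n.
  have xy := cyclic_cluster_cvg p0 c_gt0 Xconvex Tfne eps_ge0 esum x_step F_neq0 cy.
  (* The limit y has asymptotic radius 0, so it is a center of x and must equal u. *)
  suff -> : u = y by [].
  apply: (asymptotic_center_unique p0 c_gt0 Xconvex xb xu).
  apply/asymptotic_centerP => w; apply: le_trans (asymptotic_radius_ge0 x w).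
  apply/lee_addgt0Pr => e e0; rewrite add0e; apply: asymptotic_radius_le.
  exact: metricType_numDomainType.cvgr_dist_le.
Unshelve. all: by end_near. Qed.
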